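(* Let $\mathbf{A}\in\mathbb{R}^{m\times n}$, let $\mathbf{x}_0\in\mathbb{R}^n$ be a nonzero $s$-sparse vector, let $\varepsilon\ge0$ and $\mathbf{b}=\mathbf{A}\mathbf{x}_0+\mathbf{e}$ with $\|\mathbf{e}\|_2\le\varepsilon$, and let $\mathbf{x}^*$ be a minimizer of $$\min\frac{\|\mathbf{x}\|_1}{\|\mathbf{x}\|_2}\quad\text{subject to}\quad \|\mathbf{A}\mathbf{x}-\mathbf{b}\|_2\le\varepsilon .$$ Let $\mathbf{x}^*-\mathbf{x}_0=\mathbf{u}+\mathbf{w}$ with $\langle\mathbf{u},\mathbf{w}\rangle=0$ and $\mathbf{u}\ne\mathbf{0}$, and assume that $$\beta:=4\sqrt{2s}\,\frac{\|\mathbf{u}\|_2}{\|\mathbf{u}\|_1}<1.$$ Let $\alpha\in(\beta,1)$ be any number, and consider the two conditions $$\text{(a)}\ \ \langle\mathbf{x}_0,\mathbf{x}^*\rangle\ge(1-\alpha^2/2)\|\mathbf{x}_0\|_2\|\mathbf{x}^*\|_2,\qquad \text{(b)}\ \ \|\mathbf{x}_0\|_2\le\|\mathbf{x}^*\|_2\le(1+\alpha)\|\mathbf{x}_0\|_2.$$ Then: (i) If both (a) and (b) hold, then $\|\mathbf{x}^*-\mathbf{x}_0\|_2\le2\sqrt{\alpha}\,\|\mathbf{x}_0\|_2$. (ii) If at least one of (a), (b) is violated, then for either $p=1$ or $p=2$ (that is, for at least one of these two values of $p$), $$\|\mathbf{x}^*-\mathbf{x}_0\|_p\le\frac{2\a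lpha-\beta}{\alpha-\beta}\,\|\mathbf{w}\|_p.$$
   Context: A vector is $s$-sparse if it has at most $s$ nonzero entries. The minimization is over nonzero vectors $\mathbf{x}$, where the objective is defined. *)

(* Defs.v *)
From mathcomp Require Import all_boot all_order all_algebra.
From mathcomp Require Import reals.
Set Implicit Arguments.
Unset Strict Implicit.
Unset Printing Implicit Defensive.
Import Order.TTheory GRing.Theory Num.Theory.
Local Open Scope ring_scope.

(* The norm `|x| that MathComp-Analysis puts on matrices is the sup norm, so
   the l1 and l2 norms are defined here. *)
Definition norm1 (R : realType) (n : nat) (x : 'cV[R]_n) : R :=
  \sum_(i < n) `|x i 0|.

Definition norm2 (R : realType) (n : nat) (x : 'cV[R]_n) : R :=
  Num.sqrt (\sum_(i < n) x i 0 ^+ 2).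

Definition dot (R : realType) (n : nat) (x y : 'cV[R]_n) : R :=
  \sum_(i < n) x i 0 * y i 0.

Definition sparse (R : realType) (n s : nat) (x : 'cV[R]_n) : Prop :=
  (#|[set i : 'I_n | (x i 0 != 0)%R]| <= s)%N.

Definition l1_over_l2 (R : realType) (n : nat) (x : 'cV[R]_n) : R :=
  norm1 x / norm2 x.

Definition feasible (R : realType) (m n : nat) (A : 'M[R]_(m, n))
    (b : 'cV[R]_m) (eps : R) (x : 'cV[R]_n) : Prop :=
  norm2 (A *m x - b) <= eps.

(* Both the minimizer and its competitors must be nonzero: in a field with
   0^-1 = 0 the zero vector would otherwise have objective value 0. *)
Definition l1_over_l2_minimizer (R : realType) (m n : nat)
    (A : 'M[R]_(m, n)) (b : 'cV[R]_m) (eps : R) (x : 'cV[R]_n) : Prop :=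
  [/\ x != 0, feasible A b eps x
    & forall y : 'cV[R]_n, y != 0 -> feasible A b eps y ->
        l1_over_l2 x <= l1_over_l2 y].

(* Main.v *)
(** Suppose both bounds in (ii) fail and put h = x* - x0. Then w is dominated by u in
    both norms, so orthogonality gives |h|_1 > (4 sqrt s / alpha) |h|_2. Minimality of
    x* gives |x*|_1 <= (|x*|_2 / |x0|_2) |x0|_1. If |x*|_2 < |x0|_2, this puts h in the
    cone |h|_1 <= 2 sqrt s |h|_2, a contradiction. Otherwise
    |h|_1 <= |x0|_1 + |x*|_1 <= sqrt s (|x0|_2 + |x*|_2), so that
    |h|_2 < (alpha / 4) (|x0|_2 + |x*|_2), which forces (a) and the rest of (b). *)

Require Import Defs.
From mathcomp Require Import all_boot all_order all_algebra.
From mathcomp Require Import reals ring lra.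
Import Order.TTheory GRing.Theory Num.Theory.
Local Open Scope ring_scope.

Section Norms.
Context {R : realType} {n : nat}.
Implicit Types (x y h : 'cV[R]_n) (S : {set 'I_n}).

Lemma norm2_ge0 x : 0 <= norm2 x. Proof. exact: sqrtr_ge0. Qed.

Lemma norm1_ge0 x : 0 <= norm1 x. Proof. exact: sumr_ge0. Qed.

Lemma norm2_sqr x : norm2 x ^+ 2 = dot x x.
Proof.
rewrite sqr_sqrtr; first by apply: eq_bigr => i _; rewrite expr2.
by apply: sumr_ge0 => i _; exact: sqr_ge0.
Qed.

Lemma norm2_eq0 x : norm2 x = 0 -> x = 0.
Proof.
move=> x0; apply/matrixP => i j; rewrite ord1 mxE.
have xx0 : dot x x = 0 by rewrite -norm2_sqr x0 expr0n.
apply/eqP; rewrite -sqrf_eq0 expr2 (psumr_eq0P _ xx0) // => k _.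
by rewrite -expr2 sqr_ge0.
Qed.

Lemma norm2_gt0 x : x != 0 -> 0 < norm2 x.
Proof.
by move=> x0; rewrite lt0r norm2_ge0 andbT; apply: contra_neq x0; exact: norm2_eq0.
Qed.

Lemma norm1_gt0 x : x != 0 -> 0 < norm1 x.
Proof.
move=> x0; rewrite lt0r norm1_ge0 andbT; apply: contra_neq x0 => x0.
by apply/matrixP => i j; rewrite ord1 mxE; apply: normr0_eq0; rewrite (psumr_eq0P _ x0).
Qed.

Lemma dotC x y : dot x y = dot y x.
Proof. by apply: eq_bigr => i _; rewrite mulrC. Qed.

Lemma dotDl x y z : dot (x + y) z = dot x z + dot y z.
Proof. by rewrite -big_split; apply: eq_bigr => i _; rewrite mxE mulrDl. Qed.

Lemma dotZl c x y : dot (c *: x) y = c * dot x y.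
Proof. by rewrite /dot mulr_sumr; apply: eq_bigr => i _; rewrite mxE mulrA. Qed.

Lemma norm2_sqrDZ c x y :
  norm2 (x + c *: y) ^+ 2 = norm2 x ^+ 2 + 2 * c * dot x y + c ^+ 2 * norm2 y ^+ 2.
Proof.
rewrite !norm2_sqr dotDl dotZl !(dotC _ (x + _)) !dotDl !dotZl (dotC y x).
by ring.
Qed.

Lemma norm2_sqrD x y : norm2 (x + y) ^+ 2 = norm2 x ^+ 2 + 2 * dot x y + norm2 y ^+ 2.
Proof. by rewrite -{1}[y]scale1r norm2_sqrDZ; ring. Qed.

Lemma norm2_sqrB x y : norm2 (x - y) ^+ 2 = norm2 x ^+ 2 - 2 * dot x y + norm2 y ^+ 2.
Proof. by rewrite -scaleN1r norm2_sqrDZ; ring. Qed.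

(** Expand the square of [x] minus its projection onto [y]. Arguing by contradiction makes [dot x y]
    nonnegative, so that squares can be compared. *)
Lemma dot_le_norm2 x y : dot x y <= norm2 x * norm2 y.
Proof.
have [->|/norm2_gt0 y0] := eqVneq y 0.
  by rewrite /dot big1 ?mulr_ge0 ?norm2_ge0 // => i _; rewrite mxE mulr0.
rewrite leNgt; apply/negP => lt_dot.
have := sqr_ge0 (norm2 (x + (- (dot x y / norm2 y ^+ 2)) *: y)).
have -> : norm2 (x + (- (dot x y / norm2 y ^+ 2)) *: y) ^+ 2
    = (norm2 x ^+ 2 * norm2 y ^+ 2 - dot x y ^+ 2) / norm2 y ^+ 2.
  by rewrite norm2_sqrDZ; field; rewrite lt0r_neq0.
rewrite pmulr_lge0 ?invr_gt0 ?exprn_gt0 // subr_ge0 -exprMn.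
by rewrite leNgt => /negP; apply; rewrite ltrXn2r // ?mulr_ge0 ?norm2_ge0.
Qed.

(** Cauchy-Schwarz for the indicator vector of [S] and the vector of absolute values of [x]. *)
Lemma sum_norm_le_sqrt_card S x :
  \sum_(i in S) `|x i 0| <= Num.sqrt #|S|%:R * norm2 x.
Proof.
pose y : 'cV[R]_n := \col_i (i \in S)%:R.
pose z : 'cV[R]_n := \col_i `|x i 0|.
have -> : \sum_(i in S) `|x i 0| = dot y z.
  rewrite big_mkcond; apply: eq_bigr => i _.
  by rewrite !mxE; case: (i \in S); rewrite ?mul1r ?mul0r.
have -> : Num.sqrt #|S|%:R = norm2 y.
  congr Num.sqrt; rewrite -sum1_card natr_sum big_mkcond.
  by apply: eq_bigr => i _; rewrite mxE; case: (i \in S); rewrite ?expr1n ?expr0n.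
suff -> : norm2 x = norm2 z by exact: dot_le_norm2.
by congr Num.sqrt; apply: eq_bigr => i _; rewrite mxE real_normK ?num_real.
Qed.

Lemma ler_norm1D x y : norm1 (x + y) <= norm1 x + norm1 y.
Proof. by rewrite -big_split; apply: ler_sum => i _; rewrite mxE ler_normD. Qed.

Lemma norm1N x : norm1 (- x) = norm1 x.
Proof. by apply: eq_bigr => i _; rewrite mxE normrN. Qed.

Lemma ler_norm1B x y : norm1 (x - y) <= norm1 x + norm1 y.
Proof. by rewrite -(norm1N y) ler_norm1D. Qed.

Lemma sparse_norm1_le s x : sparse s x -> norm1 x <= Num.sqrt s%:R * norm2 x.
Proof.
move=> sx; rewrite /norm1 (bigID (mem [set i | x i 0 != 0])) /= [X in _ + X]big1 => [|i].
  rewrite addr0; apply: le_trans (sum_norm_le_sqrt_card _ _) _.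
  by rewrite ler_wpM2r ?norm2_ge0 // ler_wsqrtr // ler_nat.
by rewrite inE negbK => /eqP ->; rewrite normr0.
Qed.

(** Off the support [S] of [x], [x + h] is just [h]; hence the l1 mass of [h] off [S] is at most its
    mass on [S], where Cauchy-Schwarz applies. *)
Lemma sparse_cone s x h : sparse s x -> norm1 (x + h) <= norm1 x ->
  norm1 h <= 2 * Num.sqrt s%:R * norm2 h.
Proof.
move=> sx; pose S := [set i | x i 0 != 0].
have hS : \sum_(i in S) `|h i 0| <= Num.sqrt s%:R * norm2 h.
  apply: le_trans (sum_norm_le_sqrt_card _ _) _.
  by rewrite ler_wpM2r ?norm2_ge0 // ler_wsqrtr // ler_nat.
have xSC i : i \notin S -> x i 0 = 0 by rewrite inE negbK => /eqP.
rewrite /norm1 !(bigID (mem S) predT) /= [X in _ <= _ + X -> _]big1 => [|i /xSC ->]; last first.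
  by rewrite normr0.
have -> : \sum_(i | i \notin S) `|(x + h) i 0| = \sum_(i | i \notin S) `|h i 0|.
  by apply: eq_bigr => i /xSC xi0; rewrite mxE xi0 add0r.
have : \sum_(i in S) `|x i 0| <= \sum_(i in S) `|(x + h) i 0| + \sum_(i in S) `|h i 0|.
  rewrite -big_split; apply: ler_sum => i _; rewrite mxE.
  by rewrite -{1}[x i 0](addrK (h i 0)) ler_normB.
by lra.
Qed.

End Norms.

Lemma sparse_gt0 (R : realType) (n s : nat) (x : 'cV[R]_n) :
  x != 0 -> sparse s x -> (0 < s)%N.
Proof.
move=> x0; apply: leq_trans; rewrite card_gt0; apply: contra_neq x0 => S0.
by apply/matrixP => i j; rewrite ord1 mxE; have := in_set0 i; rewrite -S0 inE => /negbFE/eqP.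
Qed.

Theorem theorem5p1 (R : realType) (m n s : nat) (A : 'M[R]_(m, n))
    (x0 : 'cV[R]_n) (hx0 : x0 != 0) (hs : sparse s x0)
    (eps : R) (heps : 0 <= eps)
    (e b : 'cV[R]_m) (hb : b = A *m x0 + e) (he : norm2 e <= eps)
    (xs : 'cV[R]_n) (hxs : l1_over_l2_minimizer A b eps xs)
    (u w : 'cV[R]_n) (huw : xs - x0 = u + w) (horth : dot u w = 0)
    (hu : u != 0)
    (beta : R)
    (hbeta : beta = 4%:R * Num.sqrt ((2 * s)%:R) * (norm2 u / norm1 u))
    (hbeta1 : beta < 1)
    (alpha : R) (halpha : beta < alpha) (halpha1 : alpha < 1) :
  let condA : Prop :=
    (1 - alpha ^+ 2 / 2%:R) * norm2 x0 * norm2 xs <= dot x0 xs in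
  let condB : Prop :=
    norm2 x0 <= norm2 xs /\ norm2 xs <= (1 + alpha) * norm2 x0 in
  (condA /\ condB -> norm2 (xs - x0) <= 2%:R * Num.sqrt alpha * norm2 x0)
  /\
  (~ condA \/ ~ condB ->
     norm1 (xs - x0) <= (2%:R * alpha - beta) / (alpha - beta) * norm1 w
     \/
     norm2 (xs - x0) <= (2%:R * alpha - beta) / (alpha - beta) * norm2 w).
Proof.
move=> condA condB.
set r := norm2 x0; set t := norm2 xs; set h := xs - x0.
have r0 : 0 < r := norm2_gt0 _ hx0.
have t0 : 0 < t by case: hxs => /norm2_gt0.
have u20 := norm2_gt0 _ hu.
have u10 := norm1_gt0 _ hu.
have s0 : 0 < (s%:R : R) by rewrite ltr0n (sparse_gt0 _ _ _ _ hx0 hs).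
have sq0 : 0 < Num.sqrt (s%:R : R) by rewrite sqrtr_gt0.
have h2E : norm2 h ^+ 2 = t ^+ 2 - 2 * dot x0 xs + r ^+ 2.
  by rewrite norm2_sqrB dotC.
have h20 := norm2_ge0 h.
have beta0 : 0 <= beta.
  by rewrite hbeta !mulr_ge0 ?invr_ge0 ?sqrtr_ge0 ?norm1_ge0 ?norm2_ge0.
have alpha0 : 0 < alpha by lra.
split=> [[hA [rt tr]]|hAB].
  (* By (a), |h|_2^2 <= (t - r)^2 + alpha^2 r t; by (b) this is at most alpha^2 (2 + alpha) r^2, and
     alpha (2 + alpha) <= 4. *)
  rewrite -ler_sqr ?nnegrE ?mulr_ge0 ?sqrtr_ge0 ?(ltW r0) // !exprMn.
  rewrite [Num.sqrt alpha ^+ 2]sqr_sqrtr ?(ltW alpha0) //.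
  rewrite h2E; move: hA rt tr; rewrite /condA -/r -/t => hA rt tr.
  have tr2 : (t - r) ^+ 2 <= (alpha * r) ^+ 2.
    by rewrite ler_sqr ?nnegrE ?mulr_ge0 //; lra.
  have rt2 : alpha ^+ 2 * r * t <= alpha ^+ 2 * r * ((1 + alpha) * r).
    by rewrite ler_wpM2l // !mulr_ge0 //; lra.
  have a3 : alpha ^+ 2 * (2 + alpha) * r ^+ 2 <= 4 * alpha * r ^+ 2.
    by rewrite ler_wpM2r ?sqr_ge0 //; nra.
  by lra.
have [h1w|h1w] := leP (norm1 h) ((2%:R * alpha - beta) / (alpha - beta) * norm1 w).
  by left.
right; rewrite leNgt; apply/negP => h2w.
have ab0 : 0 < alpha - beta by lra.
move: h1w h2w; rewrite -/h mulrAC ltr_pdivrMr // mulrAC ltr_pdivrMr // => h1w h2w.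
have w20 := norm2_ge0 w.
have hu1 : norm1 h <= norm1 u + norm1 w by rewrite /h huw ler_norm1D.
have uh1 : norm1 u <= norm1 h + norm1 w by rewrite -{1}[u](addrK w) -huw ler_norm1B.
(* Since beta <= 2 alpha - beta, [h1w] gives beta |w|_1 < (alpha - beta) |h|_1; add beta |h|_1 and
   use [uh1]. *)
have bu1 : beta * norm1 u < alpha * norm1 h by nra.
have hpyth : norm2 h ^+ 2 = norm2 u ^+ 2 + norm2 w ^+ 2.
  by rewrite /h huw norm2_sqrD horth; ring.
(* Here 2 (alpha - beta) <= 2 alpha - beta is used. With [hpyth] it yields |h|_2^2 <= (4/3) |u|_2^2,
   more than enough for the factor sqrt 2 contained in [beta]. *)
have w2h : 2 * norm2 w <= norm2 h by nra.
have h2u : norm2 h <= Num.sqrt 2 * norm2 u.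
  rewrite -ler_sqr ?nnegrE ?mulr_ge0 ?sqrtr_ge0 ?norm2_ge0 // exprMn [Num.sqrt 2 ^+ 2]sqr_sqrtr //.
  by nra.
have betau : beta * norm1 u = 4 * Num.sqrt 2 * Num.sqrt s%:R * norm2 u.
  by rewrite hbeta natrM sqrtrM //; field; rewrite lt0r_neq0.
have h21 : 4 * Num.sqrt s%:R * norm2 h < alpha * norm1 h.
  apply: le_lt_trans bu1; rewrite betau; nra.
(* [x0] competes with the minimizer: its residual is [- e]. *)
have xs1 : norm1 xs <= t / r * norm1 x0.
  have x0f : feasible A b eps x0.
    rewrite /feasible hb opprD addrA subrr add0r.
    by rewrite /norm2 (eq_bigr (fun i => e i 0 ^+ 2)) // => i _; rewrite mxE sqrrN.
  have [_ _ /(_ _ hx0 x0f)] := hxs.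
  by rewrite /l1_over_l2 -/t -/r ler_pdivrMr // => /le_trans -> //; rewrite mulrC mulrA mulrAC.
have x01 : norm1 x0 <= Num.sqrt s%:R * r := sparse_norm1_le _ _ hs.
have [tr|rt] := ltP t r.
  have : norm1 h <= 2 * Num.sqrt s%:R * norm2 h.
    apply: (sparse_cone _ _ _ hs); rewrite addrC subrK.
    apply: le_trans xs1 _; rewrite ler_piMl ?norm1_ge0 // ler_pdivrMr // mul1r; exact: ltW.
  (* As alpha < 1, the cone bound contradicts [h21]. *)
  have := norm1_ge0 h; nra.
have h2rt : 4 * norm2 h < alpha * (r + t).
  have : norm1 h <= Num.sqrt s%:R * (r + t).
    apply: le_trans (ler_norm1B _ _) _.
    have : t / r * norm1 x0 <= t / r * (Num.sqrt s%:R * r).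
      by rewrite ler_wpM2l // divr_ge0 ?ltW.
    have -> : t / r * (Num.sqrt s%:R * r) = Num.sqrt s%:R * t by field; rewrite lt0r_neq0.
    by lra.
  move=> /(ler_wpM2l (ltW alpha0)) /(lt_le_trans h21).
  by rewrite mulrAC [ltRHS]mulrCA [ltLHS]mulrC ltr_pM2l.
have h2rt2 : 16 * norm2 h ^+ 2 < alpha ^+ 2 * (r + t) ^+ 2.
  have := h2rt; rewrite -ltr_sqr ?nnegrE ?mulr_ge0 //; [by rewrite !exprMn; lra|by lra|by lra].
(* If (a) failed, |h|_2^2 would exceed (t - r)^2 + alpha^2 r t; with 4 r t = (r + t)^2 - (t - r)^2
   this contradicts [h2rt2]. *)
have hA : condA.
  rewrite /condA -/r -/t leNgt; apply/negP => hA.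
  have : (1 - alpha ^+ 2) * (t - r) ^+ 2 >= 0 by rewrite mulr_ge0 ?sqr_ge0 //; nra.
  have := sqr_ge0 (alpha * (r + t)); have := sqr_ge0 (t - r); lra.
have hB : condB.
  split=> //; rewrite -/r -/t leNgt; apply/negP => tr.
  (* Reverse triangle inequality. Then [h2rt] gives (4 - alpha) (t - r) < 2 alpha r, impossible when
     t - r > alpha r and alpha < 1. *)
  have trh : t - r <= norm2 h.
    rewrite -ler_sqr ?nnegrE ?subr_ge0 // h2E.
    by have := dot_le_norm2 x0 xs; rewrite -/r -/t; lra.
  by nra.
by case: hAB; apply.
Qed.
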